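(* Let $l_1,\ldots,l_n$ be positive integers, $N=\sum_{i=1}^n l_i$, and let $\mathcal{A}\in\{0,*,?\}^{N\times N}$ be a pattern matrix partitioned into blocks $\mathcal{A}_{ij}\in\{0,*,?\}^{l_i\times l_j}$, $1\leq i,j\leq n$. Let $1\leq i,j\leq n$ with $i\neq j$, consider the graph $G_{\{i,j\}}$, and let $Z=\emptyset$ be the initial set of black vertices. Then $\mathcal{A}_{ij}$ has full row rank if and only if $V_i\subseteq\mathcal{D}(Z)$, where $\mathcal{D}(Z)$ is the derived set of $Z$ in $G_{\{i,j\}}$.
   Context: Pattern matrices. A pattern matrix has entries in the set of symbols $\{0,*,?\}$. For a $q\times p$ pattern matrix $\mathcal{M}$, its pattern class $\mathcal{P}(\mathcal{M})$ is the set of all $M\in\mathbb{R}^{q\times p}$ with $M(a,b)=0$ whenever $\mathcal{M}(a,b)=0$ and $M(a,b)\neq 0$ whenever $\mathcal{M}(a,b)=*$ (entries with symbol $?$ are arbitrary reals). $\mathcal{M}$ has full row rank if every $M\in\mathcal{P}(\mathcal{M})$ has full row rank. The graph $G_{\{i,j\}}$. Let $V_i=\{i^1,\ldots,i^{l_i}\}$ and $V_j=\{j^1,\ldots,j^{l_j}\}$ be disjoint vertex sets. Let $E_{j\rightarrow i}$ be the set of directed edges $(j^b,i^a)$ with $\mathcal{A}_{ij}(a,b)\neq 0$, and $E_{i\rightarrow j}$ the set of directed edges $(i^b,j^a)$ with $\mathcal{A}_{ji}(a,b)\neq 0$. An edge belongs to $E^*$ if the corresponding pattern entry is $*$ and to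 $E^?$ if it is $?$. Then $G_{\{i,j\}}=(V_i\cup V_j,\,E_{i\rightarrow j}\cup E_{j\rightarrow i})$. If $(v,u)$ is an edge, $u$ is an out-neighbor of $v$. Coloring. Start with the vertices of a set $Z$ black and all others white. Coloring rule: a white vertex $u$ is colored black if there is a vertex $v$ (black or white) such that $u$ is the only white out-neighbor of $v$ and $(v,u)\in E^*$. Apply the rule repeatedly until no further change is possible; the final set of black vertices is the derived set $\mathcal{D}(Z)$. *)

(* Defs.v *)
(* The field of real numbers is an arbitrary [R : realType]. *)
From HB Require Import structures.
From mathcomp Require Import all_boot all_order all_algebra.
From mathcomp Require Import reals.

Set Implicit Arguments.
Unset Strict Implicit.
Unset Printing Implicit Defensive.

Import GRing.Theory.
Local Open Scope ring_scope.

(* The symbols 0, * and ? respectively. *)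
Inductive psym := PZero | PStar | PAny.

Definition psym_to_ord (s : psym) : 'I_3 :=
  match s with
  | PZero => inord 0
  | PStar => inord 1
  | PAny => inord 2
  end.

Definition psym_of_ord (k : 'I_3) : psym :=
  match val k with
  | 0%N => PZero
  | 1%N => PStar
  | _ => PAny
  end.

Lemma psym_to_ordK : cancel psym_to_ord psym_of_ord.
Proof. by case; rewrite /psym_of_ord /= inordK. Qed.

HB.instance Definition _ := Equality.copy psym (can_type psym_to_ordK).

Definition pattern_class (R : realType) q p (P : 'M[psym]_(q, p))
    (M : 'M[R]_(q, p)) : Prop :=
  forall a b, (P a b = PZero -> M a b = 0) /\ (P a b = PStar -> M a b <> 0).

(* [row_free M] unfolds to [\rank M == q]. *)
Definition pattern_full_row_rank (R : realType) q p (P : 'M[psym]_(q, p)) :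
    Prop :=
  forall M : 'M[R]_(q, p), pattern_class P M -> row_free M.

(* A directed graph on T whose edge set is split into E^* and E^?;
   [star_edge G v u] means (v, u) \in E^*. *)
Record pattern_graph (T : finType) := PatternGraph {
  star_edge : rel T;
  any_edge : rel T
}.

Definition edge (T : finType) (G : pattern_graph T) : rel T :=
  fun v u => star_edge G v u || any_edge G v u.

Section Coloring.
Variables (T : finType) (G : pattern_graph T).
Implicit Types (Z B C D : {set T}) (u v w : T).

(* [B] is the current set of black vertices; membership of u in the singleton
   on the right makes u white. *)
Definition colorable B u : bool :=
  [exists v, star_edge G v u
             && ([set w | edge G v w & w \notin B] == [set u])].

Definition color_one B : {set T} :=
  if [pick u | colorable B u] is Some u then u |: B else B.

(* Each effective application of the rule blackens a new vertex, so #|T|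
   applications exhaust it. The order chosen by [color_one] is irrelevant:
   see [derived_setP]. *)
Definition derived_set Z : {set T} := iter #|T| color_one Z.

(* The sets of black vertices that can be reached from Z by applying the
   coloring rule one vertex at a time, in any order. *)
Inductive coloring Z : {set T} -> Prop :=
| coloring_start : coloring Z Z
| coloring_step B u : coloring Z B -> colorable B u -> coloring Z (u |: B).

Lemma colorable_white B u : colorable B u -> u \notin B.
Proof.
case/existsP=> v /andP[_ /eqP/setP/(_ u)].
by rewrite !inE eqxx => /andP[].
Qed.

Lemma colorableS B C u :
  B \subset C -> u \notin C -> colorable B u -> colorable C u.
Proof.
move=> sBC uC /existsP[v /andP[vu /eqP Bv]]; apply/existsP; exists v.
rewrite vu /=; apply/eqP/setP=> w; have /setP/(_ w) := Bv; rewrite !inE.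
case: (eqVneq w u) => [->|_] ; first by rewrite uC => /andP[->].
case: (edge G v w) => //= wB; apply/negbTE; rewrite negbK.
by apply: (subsetP sBC); move/negbT: wB; rewrite negbK.
Qed.

Lemma coloring_stable_sub Z B D :
  Z \subset D -> (forall u, ~~ colorable D u) -> coloring Z B -> B \subset D.
Proof.
move=> sZD stD; elim=> // C u _ sCD Cu; rewrite subUset sCD sub1set andbT.
by apply: contraT => uD; have := stD u; rewrite (colorableS sCD uD Cu).
Qed.

Lemma coloring_sub Z B : coloring Z B -> Z \subset B.
Proof. by elim=> // C u _ sZC _; apply: subset_trans sZC (subsetUr _ _). Qed.

Lemma coloring_derived Z : coloring Z (derived_set Z).
Proof.
rewrite /derived_set; elim: #|T| => [|k IH] /=; first exact: coloring_start.
by rewrite {1}/color_one; case: pickP => // u; apply: coloring_step.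
Qed.

Lemma derived_set_stable Z u : ~~ colorable (derived_set Z) u.
Proof.
have iter_stable k :
    (forall u, ~~ colorable (iter k color_one Z) u)
    \/ (k <= #|iter k color_one Z|)%N.
  elim: k => [|k [IH|IH]]; [by right | left | ] => /=.
    move=> w; rewrite /color_one; case: pickP => [x|_]; last exact: IH.
    by rewrite (negbTE (IH x)).
  rewrite /color_one; case: pickP => [x Cx|C0].
    by right; rewrite cardsU1 (colorable_white Cx).
  by left=> w; rewrite C0.
case: (iter_stable #|T|) => [-> //|leT].
have/eqP DT : derived_set Z == setT.
  by rewrite eqEcard subsetT cardsT.
by apply/negP=> /colorable_white; rewrite DT inE.
Qed.

(* Every exhaustive application of the rule ends in the derived set. *)
Lemma derived_setP Z D :
  (coloring Z D /\ forall u, ~~ colorable D u) <-> D = derived_set Z.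
Proof.
split=> [[ZD stD]|->]; last first.
  by split; [exact: coloring_derived | exact: derived_set_stable].
apply/eqP; rewrite eqEsubset; apply/andP; split.
  apply: (coloring_stable_sub _ _ ZD); last exact: derived_set_stable.
  exact: coloring_sub (coloring_derived Z).
exact: (coloring_stable_sub (coloring_sub ZD) stD (coloring_derived Z)).
Qed.

End Coloring.

Section PairGraph.
Variables (n : nat) (l : 'I_n -> nat).
Variables (A : 'M[psym]_(\sum_k l k)) (i j : 'I_n).

(* The disjoint union of V_i (left summand) and V_j (right summand). *)
Definition pair_vertex : finType := ('I_(l i) + 'I_(l j))%type.

(* The edges from v to u that carry the symbol s: (j^b, i^a) corresponds to
   A_ij(a, b), and (i^b, j^a) to A_ji(a, b). *)
Definition symbol_edge (s : psym) : rel pair_vertex := fun v u =>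
  match v, u with
  | inr b, inl a => submxblock A i j a b == s
  | inl b, inr a => submxblock A j i a b == s
  | _, _ => false
  end.

Definition pair_graph : pattern_graph pair_vertex :=
  PatternGraph (symbol_edge PStar) (symbol_edge PAny).

Definition left_vertices : {set pair_vertex} :=
  [set inl a | a : 'I_(l i)].

End PairGraph.

(* Main.v *)
(* If [x *m M = 0] with [M] in the pattern class of A_ij, each application of
   the coloring rule to a vertex a of V_i isolates, in some column b, the single
   equation [x a * M a b = 0] with [M a b != 0]; so [x] vanishes on the black
   vertices. Conversely, if the white part W of V_i is nonempty, no column
   forces a further vertex, and nonzero entries can be chosen so that the rows
   indexed by W add up to zero. *)
Require Import Defs.
From HB Require Import structures.
From mathcomp Require Import all_boot all_order all_algebra.
From mathcomp Require Import reals.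

Set Implicit Arguments.
Unset Strict Implicit.
Unset Printing Implicit Defensive.

Import GRing.Theory Num.Theory.

Lemma edge_pair_graph (n : nat) (l : 'I_n -> nat) (A : 'M[psym]_(\sum_k l k))
    (i j : 'I_n) (a : 'I_(l i)) (b : 'I_(l j)) :
  edge (pair_graph A i j) (inr b) (inl a) = (submxblock A i j a b != PZero).
Proof.
rewrite /edge [star_edge _ _ _]/= [any_edge _ _ _]/=.
by case: (submxblock A i j a b); do ?[case: eqP => //].
Qed.

Lemma coloring_left_kernel (R : realType) (n : nat) (l : 'I_n -> nat)
    (A : 'M[psym]_(\sum_k l k)) (i j : 'I_n) (M : 'M[R]_(l i, l j))
    (x : 'rV[R]_(l i)) (B : {set pair_vertex l i j}) :
  pattern_class (submxblock A i j) M -> (x *m M = 0)%R ->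
  coloring (pair_graph A i j) set0 B ->
  forall a, inl a \in B -> x ord0 a = 0%R.
Proof.
move=> PM xM0; elim=> [|C u _ xC0 uP] a; first by rewrite inE.
rewrite in_setU1 => /orP[/eqP ua|/xC0 //]; rewrite -{u}ua in uP.
(* Only vertices of V_j have edges into V_i, so the forcing vertex is a column [b] of A_ij. *)
case/existsP: uP => -[//|b] /andP[/= /eqP abS /eqP Cab].
have /matrixP/(_ ord0 b) := xM0; rewrite !mxE (bigD1 a) //= big1 ?addr0.
  by move/eqP; rewrite mulf_eq0 => /orP[/eqP //|/eqP /(proj2 (PM a b) abS)].
move=> c ca; have /setP/(_ (inl c)) := Cab.
rewrite !inE edge_pair_graph (inj_eq (@inl_inj _ _)) (negbTE ca).
(* Every other row [c] drops out of the equation: either the pattern makes [M c b] zero, or [c] is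
   already black and [x] vanishes there. *)
have [/(proj1 (PM c b)) ->|_ /negbFE/xC0 ->] := eqVneq; first by rewrite mulr0.
by rewrite mul0r.
Qed.

Section BalancedMatrix.
Variables (R : realType) (q p : nat) (P : 'M[psym]_(q, p)) (W : {set 'I_q}).

(** When [W] is the white part of V_i, these are the white out-neighbors of j^b. *)
Definition column_support (b : 'I_p) : {set 'I_q} :=
  [set a in W | P a b != PZero].

(* In each column, one row of W carries the negated sum of the other rows of
   W, all of whose nonzero entries are 1. *)
Definition balanced_mx : 'M[R]_(q, p) :=
  \matrix_(a, b)
    ((P a b != PZero)%:R
     - #|column_support b|%:R *+ ([pick c in column_support b] == Some a))%R.

Lemma balanced_mx_sum b : (\sum_(a in W) balanced_mx a b = 0)%R.
Proof.
under eq_bigr do rewrite mxE.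
rewrite sumrB -natr_sum.
have -> : (\sum_(a in W) (P a b != PZero) = #|column_support b|)%N.
  by rewrite -big_mkcondr /= sum1dep_card.
case: pickP => [c cS|S0]; last first.
  by rewrite (eq_card0 S0) big1 ?subr0 // => a _; rewrite mul0rn.
have cW : c \in W by move: cS; rewrite inE => /andP[].
rewrite (bigD1 c) //= eqxx big1 ?addr0 ?subrr // => a /andP[_ ac].
by rewrite (inj_eq Some_inj) eq_sym (negbTE ac).
Qed.

(** The picked entry of column [b] is [1 - #|column_support b|], which in characteristic zero
    vanishes only for a singleton support; the hypothesis excludes this at a star. *)
Lemma balanced_mx_class :
    (forall a b, P a b = PStar -> column_support b <> [set a]) ->
  pattern_class P balanced_mx.
Proof.
move=> Pfree a b; rewrite mxE; split=> Pab; rewrite Pab; case: eqP => //= _.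
  case: pickP => [c cS|_]; last by rewrite subr0.
  case: eqP => [[ca]|_]; last by rewrite subr0.
  by move: cS; rewrite ca inE Pab eqxx andbF.
case: pickP => [c cS|_]; last by rewrite subr0; apply/eqP/oner_neq0.
case: eqP => [[ca]|_]; last by rewrite subr0; apply/eqP/oner_neq0.
rewrite ca in cS; move/eqP; rewrite subr_eq0 mulr1n eq_sym pnatr_eq1.
move=> /cards1P[d Sd]; apply: (Pfree a b Pab).
by move: cS; rewrite Sd inE => /eqP ->.
Qed.

Lemma balanced_mx_not_row_free : W != set0 -> ~~ row_free balanced_mx.
Proof.
case/set0Pn=> a aW; apply/negP=> /row_free_inj Mfree.
(* The indicator row of [W] adds up the rows in [W], so it is a nonzero left kernel vector. *)
have: (\row_c (c \in W)%:R *m balanced_mx = (0 : 'rV_q) *m balanced_mx)%R.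
  apply/rowP=> b; rewrite mul0mx !mxE -[RHS](balanced_mx_sum b).
  rewrite [RHS]big_mkcond /=.
  by apply: eq_bigr => c _; rewrite mxE; case: ifP; rewrite ?mul1r ?mul0r.
move/Mfree/rowP/(_ a); rewrite !mxE aW => /eqP.
by rewrite (negbTE (oner_neq0 R)).
Qed.

End BalancedMatrix.

Theorem proposition3 (R : realType) (n : nat) (l : 'I_n -> nat)
    (l_gt0 : forall k : 'I_n, 0 < l k)
    (A : 'M[psym]_(\sum_(k < n) l k))
    (i j : 'I_n) (i_neq_j : i <> j) :
  pattern_full_row_rank R (submxblock A i j) <->
  left_vertices l i j \subset derived_set (pair_graph A i j) set0.
Proof.
set D := derived_set _ _; split=> [Afull|/subsetP sVD M PM]; last first.
  rewrite -kermx_eq0; apply/eqP/row_matrixP=> r; rewrite row0; apply/rowP=> a.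
  rewrite [RHS]mxE; apply: (coloring_left_kernel PM _ (coloring_derived _ _)).
    by rewrite -row_mul mulmx_ker row0.
  by apply: sVD; apply: imset_f.
pose W := [set a : 'I_(l i) | (inl a : pair_vertex l i j) \notin D].
have [W0|W_neq0] := eqVneq W set0.
  apply/subsetP=> _ /imsetP[a _ ->]; apply: contraT => aD.
  by have := in_set0 a; rewrite -W0 inE aD.
have /negP[] := balanced_mx_not_row_free R (submxblock A i j) W_neq0.
apply/Afull/balanced_mx_class => a b Pab /setP Sab.
(* A star at [(a, b)] with support [[set a]] would let j^b force the white vertex i^a, but [D] is
   stable. *)
have /negP[] := derived_set_stable (pair_graph A i j) set0 (inl a).
apply/existsP; exists (inr b); rewrite /= Pab eqxx /=.
apply/eqP/setP=> -[c|c]; last by rewrite !inE.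
have := Sab c; rewrite !inE edge_pair_graph andbC => ->.
by rewrite (inj_eq (@inl_inj _ _)).
Qed.
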